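(* For the $T$-round online Bayesian Stackelberg game with action feedback, with $n$ followers, $L$ leader actions, $A$ follower actions, $K$ types per follower, and an arbitrary unknown joint type distribution $\mathcal D$ on $\Theta^n$, there is an action-feedback learning algorithm for the leader whose expected regret is $$\mathbb E[\mathrm{Reg}(T)]=\widetilde O\Big(\min\big\{K^n,\ \sqrt{n^LK^LA^{2L}L}\big\}\,\sqrt T\Big),$$ where $\widetilde O(\cdot)$ omits logarithmic factors.
   Context: Game. A leader has action set $\mathcal L=[L]=\{1,\dots,L\}$, $L\ge 2$, and commits to a mixed strategy $x\in\Delta(\mathcal L)$ (probability distributions on $\mathcal L$). There are $n\ge1$ followers, each with action set $\mathcal A=[A]$ and a private type in $\Theta=[K]$. The type profile $\theta=(\theta_1,\dots,\theta_n)\in\Theta^n$ is drawn from a joint distribution $\mathcal D$. If the leader plays $\ell$ and the followers play $a=(a_1,\dots,a_n)$, the leader gets $u(\ell,a)\in[0,1]$ and follower $i$ gets $v_i(\ell,a_i,\theta_i)\in[0,1]$ (no dependence on other followers' actions). Extend linearly: $u(x,a)=\sum_\ell x(\ell)u(\ell,a)$ and $v_i(x,a_i,\theta_i)=\sum_\ell x(\ell)v_i(\ell,a_i,\theta_i)$. The utility functions are known to the leader; $\mathcal D$ is not. Best response: $\mathrm{br}_i(\theta_i,x)\in\arg\max_{a\in\mathcal A}v_i(x,a,\theta_i)$, with ties broken in favor of the leader; $\mathbf{br}(\theta,x)=(\mathrm{br}_1(\theta_1,x),\dots,\mathrm{br}_n(\theta_n,x))$. Leader's expected utility: $U_{\mathcal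 D}(x)=\mathbb E_{\theta\sim\mathcal D}[u(x,\mathbf{br}(\theta,x))]$. Optimal strategy: $x^*\in\arg\max_{x\in\Delta(\mathcal L)}U_{\mathcal D}(x)$. Online interaction. In each round $t=1,\dots,T$: the leader chooses $x^t\in\Delta(\mathcal L)$ (possibly at random) based on past feedback; types $\theta^t\sim\mathcal D$ are drawn independently across rounds; followers myopically play $a^t=\mathbf{br}(\theta^t,x^t)$. An action-feedback algorithm observes only the joint action $a^t$ after round $t$. Regret: $\mathrm{Reg}(T)=\sum_{t=1}^T\big(U_{\mathcal D}(x^* )-U_{\mathcal D}(x^t)\big)$. *)

(* Defs.v *)
From HB Require Import structures.
From mathcomp Require Import all_boot all_order all_algebra.
From mathcomp Require Import all_classical all_reals all_analysis.

Set Implicit Arguments.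
Unset Strict Implicit.
Unset Printing Implicit Defensive.

Import Order.TTheory GRing.Theory Num.Theory.
Import numFieldNormedType.Exports.

Local Open Scope classical_set_scope.
Local Open Scope ring_scope.

Record dist (R : realType) (X : finType) := Dist {
  pmf :> X -> R;
  pmf_ge0 : forall a, 0 <= pmf a;
  pmf_sum1 : \sum_a pmf a = 1 }.

Definition mixed (R : realType) (L : nat) := dist R 'I_L.
Definition action_profile (n A : nat) := {ffun 'I_n -> 'I_A}.
Definition type_profile (n K : nat) := {ffun 'I_n -> 'I_K}.

Record game (R : realType) (n L A K : nat) := Game {
  u : 'I_L -> action_profile n A -> R;
  v : 'I_n -> 'I_L -> 'I_A -> 'I_K -> R;
  u_bounded : forall l a, 0 <= u l a <= 1;
  v_bounded : forall i l b k, 0 <= v i l b k <= 1 }.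

Definition leader_utility (R : realType) (n L A K : nat) (g : game R n L A K)
    (x : mixed R L) (a : action_profile n A) : R :=
  \sum_(l < L) x l * u g l a.

Definition follower_utility (R : realType) (n L A K : nat)
    (g : game R n L A K) (i : 'I_n) (x : mixed R L) (b : 'I_A) (k : 'I_K) : R :=
  \sum_(l < L) x l * v g i l b k.

Definition best_response (R : realType) (n L A K : nat) (g : game R n L A K)
    (i : 'I_n) (k : 'I_K) (x : mixed R L) (b : 'I_A) : Prop :=
  forall b', follower_utility g i x b' k <= follower_utility g i x b k.

Definition best_response_profile (R : realType) (n L A K : nat)
    (g : game R n L A K) (th : type_profile n K) (x : mixed R L)
    (a : action_profile n A) : Prop :=
  forall i, best_response g i (th i) x (a i).

Definition response_map (R : realType) (n L A K : nat) :=
  type_profile n K -> mixed R L -> action_profile n A.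

(* The leader's preference between two tied actions of one follower depends on
   the actions of the others, so ties are broken on profiles: among all
   profiles of individual best responses, the followers play one that is best
   for the leader. *)
Definition leader_favoring_response (R : realType) (n L A K : nat)
    (g : game R n L A K) (br : response_map R n L A K) : Prop :=
  forall th x, best_response_profile g th x (br th x) /\
    forall a, best_response_profile g th x a ->
      leader_utility g x a <= leader_utility g x (br th x).

Definition expected_utility (R : realType) (n L A K : nat)
    (g : game R n L A K) (br : response_map R n L A K)
    (D : dist R (type_profile n K)) (x : mixed R L) : R :=
  \sum_th D th * leader_utility g x (br th x).

Definition optimal_strategy (R : realType) (n L A K : nat)
    (g : game R n L A K) (br : response_map R n L A K)
    (D : dist R (type_profile n K)) (xs : mixed R L) : Prop :=
  forall x, expected_utility g br D x <= expected_utility g br D xs.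

(* All the internal randomness of the leader is a seed drawn before the first
   round, independently of the types. The history is the sequence of the joint
   actions observed so far, oldest first; past strategies are functions of the
   seed and of this history. *)
Record action_feedback_algorithm (R : realType) (n L A : nat) := Algorithm {
  seed_display : measure_display;
  seed : measurableType seed_display;
  seed_law : probability seed R;
  strategy : seed -> seq (action_profile n A) -> mixed R L;
  measurable_strategy : forall h l,
    measurable_fun [set: seed] (fun w => strategy w h l) }.

Definition observed_actions (R : realType) (n L A K : nat)
    (br : response_map R n L A K) (alg : action_feedback_algorithm R n L A)
    (w : seed alg) (ths : seq (type_profile n K)) : seq (action_profile n A) :=
  foldl (fun h th => rcons h (br th (strategy w h))) [::] ths.

(* Rounds are numbered from 0. *)
Definition played_strategy (R : realType) (n L A K : nat)
    (br : response_map R n L A K) (alg : action_feedback_algorithm R n L A)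
    (w : seed alg) (ths : seq (type_profile n K)) (t : nat) : mixed R L :=
  strategy w (observed_actions br w (take t ths)).

Definition regret (R : realType) (n L A K T : nat)
    (g : game R n L A K) (br : response_map R n L A K)
    (D : dist R (type_profile n K)) (xs : mixed R L)
    (alg : action_feedback_algorithm R n L A)
    (w : seed alg) (ths : T.-tuple (type_profile n K)) : R :=
  \sum_(t < T) (expected_utility g br D xs -
                expected_utility g br D (played_strategy br w ths t)).

(* Expectation over the seed and over T independent draws from D. A response
   map may resolve leader-indifferent ties in a non-measurable way, in which
   case the integrand need not be measurable in the seed: statements about this
   expectation should also assert that the regret is measurable. *)
Definition expected_regret (R : realType) (n L A K T : nat)
    (g : game R n L A K) (br : response_map R n L A K)
    (D : dist R (type_profile n K)) (xs : mixed R L)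
    (alg : action_feedback_algorithm R n L A) : \bar R :=
  expectation (seed_law alg)
    (fun w => \sum_(ths : T.-tuple (type_profile n K))
      (\prod_(th <- ths) D th) * regret g br D xs w ths).

(* Main.v *)
(* Call a wall any hyperplane on which some type of some follower is indifferent between two
   actions, or on which a coordinate of the leader's strategy vanishes.  Inside the closed cell
   of the optimal strategy, freezing the followers' responses gives a linear lower bound for
   the leader's utility (ties favour the leader), so some vertex of the arrangement is optimal.
   A vertex is the intersection of the simplex with L - 1 walls, hence there are at most
   n^L K^L A^(2L) L of them, and the game becomes a finite-armed stochastic bandit whose
   rewards can be recomputed from the observed actions.

   The bandit is played optimistically with least squares confidence sets: the arms are split
   into blocks B, and within a block the mean reward is a linear function of a feature vector
   of dimension d.  A supermartingale over a finite grid of parameters gives the confidence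
   sets, the determinant potential bounds the accumulated widths, and the regret is
   O(d sqrt(#|B| T) (1 + ln T)).  One block with d = K^n (the parameter is the type
   distribution itself) gives the first term of the minimum; one block per vertex with d = 1
   gives the second.  Logarithms of d and #|B| are absorbed by ln T, since for T < d^2 #|B| the
   bound is weaker than the trivial bound T. *)

Require Import Defs.
From HB Require Import structures.
From mathcomp Require Import all_boot all_order all_algebra.
From mathcomp Require Import all_classical all_reals all_analysis.
From mathcomp Require Import perm ring lra zify.

Set Implicit Arguments.
Unset Strict Implicit.
Unset Printing Implicit Defensive.

Import Order.TTheory GRing.Theory Num.Theory.
Import numFieldNormedType.Exports.

Local Open Scope classical_set_scope.
Local Open Scope ring_scope.

(** * Determinants of rank-one updates and the elliptical potential *)

(** Squaring [1 - x / 2 <= expR (- (x / 2))] gives [expR x * (1 - x / 2) ^+ 2 <= 1], and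
    [(1 + x + x ^+ 2) * (1 - x / 2) ^+ 2] is at least 1 as long as [1 - 3 * x] is nonnegative. *)
Lemma expR_le_quad (R : realType) (x : R) : x <= 3^-1 -> expR x <= 1 + x + x ^+ 2.
Proof.
move=> x3; have h2 : 0 < 1 - x / 2 by lra.
have e1 : expR x * (1 - x / 2) ^+ 2 <= 1.
  have {1}-> : x = x / 2 + x / 2 by lra.
  rewrite expRD -expr2 -exprMn exprn_ile1 ?mulr_ge0 ?expR_ge0 ?(ltW h2) //.
  rewrite -{1}[x / 2]opprK expRN mulrC ler_pdivrMr ?expR_gt0 // mul1r.
  by have := @expR_ge1Dx R (- (x / 2)); lra.
have h2' : 0 < (1 - x / 2) ^+ 2 by rewrite exprn_gt0.
rewrite -(ler_pM2r h2'); apply: (le_trans e1).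
have -> : (1 + x + x ^+ 2) * (1 - x / 2) ^+ 2 =
  1 + x ^+ 2 * ((1 - 3 * x) / 4) + x ^+ 2 * (x ^+ 2 / 4) by field.
have := mulr_ge0 (sqr_ge0 x) (_ : 0 <= (1 - 3 * x) / 4).
have := mulr_ge0 (sqr_ge0 x) (_ : 0 <= x ^+ 2 / 4).
have := sqr_ge0 x; move=> x20 H1 H2.
have := H1 ltac:(lra); have := H2 ltac:(lra); lra.
Qed.

Lemma min1_le_ln (R : realType) (q : R) : 0 <= q -> Num.min 1 q <= 2 * ln (1 + q).
Proof.
move=> q0; have q1 : 0 < 1 + q by lra.
have hi : q / (1 + q) <= ln (1 + q).
  have := @le_ln1Dx R (- (q / (1 + q))).
  have -> : 1 + - (q / (1 + q)) = (1 + q)^-1 by field; lra.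
  rewrite lnV ?posrE // => H; suff : ln (1 + q) >= q / (1 + q) by [].
  rewrite -lerN2; apply: H; rewrite ltrN2 ltr_pdivrMr //; lra.
apply: le_trans (_ : 2 * (q / (1 + q)) <= _); last by rewrite ler_wpM2l.
have [q1'|q1'] := leP 1 q.
  by rewrite mulrA ler_pdivlMr //; lra.
rewrite mulrA ler_pdivlMr //; nra.
Qed.

Section RankOneUpdates.
Variables (R : realType) (d : nat).
Implicit Types (V : 'M[R]_d) (w z : 'cV[R]_d).

Definition dot w z : R := \sum_i w i 0 * z i 0.

Lemma dotE w z : (w^T *m z) 0 0 = dot w z.
Proof. by rewrite mxE; apply: eq_bigr => i _; rewrite mxE. Qed.

(** The matrix determinant lemma: the bordered matrix [M] is factored into block triangular matrices
    by eliminating either border, and the two determinants are compared. *)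
Lemma det_rank1_update V z : V \in unitmx ->
  \det (V + z *m z^T) = \det V * (1 + (z^T *m invmx V *m z) 0 0).
Proof.
move=> Vu.
pose M := block_mx V (- z) z^T (@scalar_mx _ 1 1).
have e1 : M = block_mx 1%:M (- z) 0 1%:M *m block_mx (V + z *m z^T) 0 z^T 1%:M.
  rewrite mulmx_block !mul1mx !mul0mx !mulmx1 !add0r mulNmx.
  by rewrite addrK.
have e2 : M = block_mx V 0 z^T 1%:M *m
    block_mx 1%:M (- (invmx V *m z)) 0 (1%:M + z^T *m invmx V *m z).
  rewrite mulmx_block !mulmx1 !mulmx0 !mul1mx !mul0mx !addr0.
  congr block_mx; first by rewrite mulmxN mulKVmx.
  by rewrite mulmxN mulmxA addrCA addNr addr0.
have := e1; rewrite {1}e2 => /(congr1 determinant).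
rewrite !det_mulmx !det_lblock !det_ublock !det1 !mulr1 !mul1r => <-.
by rewrite det_mx11 !mxE eqxx.
Qed.

(** Stronger than positive definiteness: [V] dominates the identity. This holds for every
    regularised Gram matrix and survives rank-one updates. *)
Definition posdef V := V^T = V /\ forall w, dot w w <= dot w (V *m w).

Lemma dot_ge0 w : 0 <= dot w w.
Proof. by apply: sumr_ge0 => i _; rewrite -expr2 sqr_ge0. Qed.

Lemma dot_eq0 w : dot w w <= 0 -> w = 0.
Proof.
move=> h; have /eqP : dot w w = 0 by apply/eqP; rewrite eq_le h dot_ge0.
rewrite psumr_eq0 => [/allP h0|i _]; last by rewrite -expr2 sqr_ge0.
apply/colP => i; rewrite mxE; apply/eqP.
by have := h0 i (mem_index_enum _); rewrite /= mulf_eq0 orbb.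
Qed.

Lemma dotC w z : dot w z = dot z w.
Proof. by apply: eq_bigr => i _; rewrite mulrC. Qed.

Lemma dotBl w1 w2 z : dot (w1 - w2) z = dot w1 z - dot w2 z.
Proof. by rewrite /dot -sumrB; apply: eq_bigr => i _; rewrite !mxE mulrBl. Qed.

Lemma dotDr w z1 z2 : dot w (z1 + z2) = dot w z1 + dot w z2.
Proof. by rewrite /dot -big_split; apply: eq_bigr => i _; rewrite !mxE mulrDr. Qed.

Lemma dotZl a w z : dot (a *: w) z = a * dot w z.
Proof. by rewrite /dot mulr_sumr; apply: eq_bigr => i _; rewrite !mxE mulrA. Qed.

Lemma dot_sym V w z : V^T = V -> dot w (V *m z) = dot z (V *m w).
Proof.
move=> sV; rewrite -!dotE; have -> : w^T *m (V *m z) = (z^T *m (V *m w))^T.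
  by rewrite !trmx_mul trmxK sV mulmxA.
by rewrite mxE.
Qed.

Lemma posdef_unit V : posdef V -> V \in unitmx.
Proof.
move=> [sV pV]; rewrite -row_free_unit -kermx_eq0; apply/eqP/row_matrixP => i.
rewrite row0; have : row i (kermx V) *m V = 0 by rewrite -row_mul mulmx_ker row0.
set r := row i _ => rV; apply: trmx_inj; rewrite trmx0.
apply: dot_eq0; apply: (le_trans (pV _)).
have -> : V *m r^T = 0 by rewrite -{1}sV -trmx_mul rV trmx0.
by rewrite -dotE mulmx0 mxE.
Qed.

(** With [y = invmx V *m z], the form of [V] is nonnegative at [q *: w - b *: y]; expanding and
    dividing by [q] gives the inequality. If [q = 0], then [z = 0]. *)
Lemma posdef_cauchy_schwarz V w z : posdef V ->
  0 <= dot z (invmx V *m z) /\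
  dot w z ^+ 2 <= dot w (V *m w) * dot z (invmx V *m z).
Proof.
move=> pdV; have Vu := posdef_unit pdV; have [sV pV] := pdV.
set y := invmx V *m z; have Vy : V *m y = z by rewrite mulKVmx.
have q0 : 0 <= dot z y.
  by rewrite dotC -{1}Vy; apply: le_trans (pV y); exact: dot_ge0.
split=> //; set q := dot z y in q0 *; set b := dot w z.
have [q1|q1] := eqVneq q 0.
  have y0 : y = 0 by apply: dot_eq0; apply: (le_trans (pV y)); rewrite Vy dotC -/q q1.
  by rewrite q1 mulr0 /b -Vy y0 mulmx0 -dotE mulmx0 mxE expr0n.
have qp : 0 < q by rewrite lt_def q1.
have := le_trans (dot_ge0 _) (pV (q *: w - b *: y)).
rewrite mulmxBr -!scalemxAr Vy.
have -> : dot (q *: w - b *: y) (q *: (V *m w) - b *: z) =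
    q * (q * dot w (V *m w) - b ^+ 2).
  rewrite dotBl !dotZl ![dot _ (_ - _)]dotC !dotBl !dotZl.
  rewrite ![dot (V *m w) _]dotC (dot_sym y w sV) Vy -/b.
  rewrite -/q -/b [dot z w]dotC -/b; ring.
by rewrite pmulr_rge0 // subr_ge0 mulrC.
Qed.

Lemma posdef1 : posdef 1%:M.
Proof. by split=> [|w]; rewrite ?trmx1 ?mul1mx. Qed.

Lemma dot_rank1 V w z : dot w ((V + z *m z^T) *m w) = dot w (V *m w) + dot w z ^+ 2.
Proof.
rewrite mulmxDl dotDr; congr (_ + _).
rewrite -mulmxA -dotE mulmxA mxE big_ord1 dotE expr2; congr (_ * _).
by rewrite dotE dotC.
Qed.

Lemma posdef_rank1 V z : posdef V -> posdef (V + z *m z^T).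
Proof.
move=> [sV pV]; split=> [|w].
  by rewrite linearD /= trmx_mul trmxK sV.
by rewrite dot_rank1; apply: le_trans (pV w) _; rewrite lerDl sqr_ge0.
Qed.

(** A term-by-term bound on the Leibniz expansion. The factorial is harmless, since only the
    logarithm of the determinant is used. *)
Lemma det_le_entries V c : 0 <= c -> (forall i j, `|V i j| <= c) ->
  \det V <= (d`!)%:R * c ^+ d.
Proof.
move=> c0 hV; apply: le_trans (ler_norm _) _.
rewrite /determinant; apply: le_trans (ler_norm_sum _ _ _) _.
apply: le_trans (_ : \sum_(s : 'S_d) c ^+ d <= _).
  apply: ler_sum => s _; rewrite normrM normrX normrN1 expr1n mul1r normr_prod.
  rewrite -[d in X in _ <= X]card_ord -prodr_const.
  by apply: ler_prod => i _; rewrite normr_ge0 hV.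
by rewrite sumr_const card_Sn mulr_natl.
Qed.

End RankOneUpdates.

Section EllipticalPotential.
Variables (R : realType) (d : nat) (B : finType).
Variables (blk : nat -> B) (z : nat -> 'cV[R]_d).

(** The Gram matrix, regularised by the identity, of the features met in block [b] before round
    [t]. *)
Fixpoint design (b : B) (t : nat) : 'M[R]_d :=
  if t is t'.+1 then
    if blk t' == b then design b t' + z t' *m (z t')^T else design b t'
  else 1%:M.

Lemma posdef_design b t : posdef (design b t).
Proof.
elim: t => [|t IH] /=; first exact: posdef1.
by case: ifP => // _; exact: posdef_rank1.
Qed.

Lemma dot_design b t (w : 'cV[R]_d) :
  dot w (design b t *m w) = dot w w + \sum_(s < t | blk s == b) dot w (z s) ^+ 2.
Proof.
elim: t => [|t IH] /=; first by rewrite mul1mx big_ord0 addr0.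
rewrite big_mkcond big_ord_recr -big_mkcond /= addrA -IH.
by case: ifP => _; rewrite ?addr0 // dot_rank1.
Qed.

Lemma det_design_ge1 b t : 1 <= \det (design b t).
Proof.
elim: t => [|t IH] /=; first by rewrite det1.
case: ifP => // _; have pd := posdef_design b t.
rewrite det_rank1_update ?posdef_unit // -mulmxA dotE.
have [q0 _] := posdef_cauchy_schwarz 0 (z t) pd.
by rewrite mulr_ege1 // lerDl.
Qed.

Lemma design_entry T b t i j : (forall s i, (s < T)%N -> 0 <= z s i 0 <= 1) ->
  (t <= T)%N -> 0 <= design b t i j <= 1 + t%:R.
Proof.
move=> hz; elim: t => [|t IH] tT /=.
  by rewrite addr0 mxE; case: eqP => _; rewrite ?lexx ?ler01.
have /andP[l u] := IH (ltnW tT).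
case: ifP => _; last by rewrite l (le_trans u) // lerD2l ler_nat.
rewrite !mxE big_ord1 !mxE -[t.+1]addn1 natrD addrA.
have /andP[l1 u1] := hz t i tT; have /andP[l2 u2] := hz t j tT.
by rewrite addr_ge0 ?mulr_ge0 //= lerD // mulr_ile1.
Qed.

(* The potential is the sum over blocks of [ln det (design b t)]: a round multiplies the
   determinant of its block by [1 + q], where [dot (w t) (z t) ^+ 2 <= beta * q]. *)
Lemma elliptical_potential (T : nat) (w : nat -> 'cV[R]_d) (beta : R) :
  1 <= beta ->
  (forall t i, (t < T)%N -> 0 <= z t i 0 <= 1) ->
  (forall t, (t < T)%N -> dot (w t) (w t) +
     \sum_(s < t | blk s == blk t) dot (w t) (z s) ^+ 2 <= beta) ->
  (forall t, (t < T)%N -> dot (w t) (z t) ^+ 2 <= 1) ->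
  \sum_(t < T) dot (w t) (z t) ^+ 2 <=
    2 * beta * (#|B|%:R * ln (d`!%:R * (1 + T%:R) ^+ d)).
Proof.
move=> b1 hz hw h1; have b0 : 0 <= beta by lra.
have pot : forall t, (t <= T)%N -> \sum_(s < t) dot (w s) (z s) ^+ 2 <=
    2 * beta * \sum_b ln (\det (design b t)).
  elim=> [|t IH] tT; first by rewrite big_ord0 mulr_ge0 ?mulr_ge0 // sumr_ge0 // => b _; rewrite ln_ge0 // det_design_ge1.
  rewrite big_ord_recr /= (bigD1 (blk t)) //= eqxx.
  under [X in _ <= _ * (_ + X)]eq_bigr => b nb do rewrite eq_sym (negbTE nb).
  have pd := posdef_design (blk t) t.
  rewrite det_rank1_update ?posdef_unit // -mulmxA dotE.
  have [q0 cs] := posdef_cauchy_schwarz (w t) (z t) pd.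
  rewrite lnM ?posrE; last 2 first.
  - exact: lt_le_trans ltr01 (det_design_ge1 _ _).
  - lra.
  rewrite addrAC mulrDr lerD //.
    by have := IH (ltnW tT); rewrite (bigD1 (blk t)).
  rewrite dot_design in cs.
  set q := dot (z t) _ in q0 cs *.
  have m1 := min1_le_ln q0; have := hw t tT; have := h1 t tT.
  set D := dot (w t) (z t) ^+ 2 in cs *; move: cs.
  set Q := _ + _ => cs D1 Qb.
  (* The squared width is at most 1, hence at most [beta], and at most [beta * q] by Cauchy-Schwarz;
     the minimum of the two is what a logarithm can dominate. *)
  apply: le_trans (_ : beta * Num.min 1 q <= _); last by rewrite [2 * beta]mulrC -mulrA ler_wpM2l.
  rewrite minr_pMr // mulr1 le_min (le_trans D1 b1) (le_trans cs) //.
  exact: ler_wpM2r.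
apply: le_trans (pot T (leqnn T)) _.
rewrite ler_wpM2l ?mulr_ge0 // -sum1_card natr_sum mulr_suml.
apply: ler_sum => b _; rewrite mul1r ler_ln ?posrE.
- apply: det_le_entries; first by rewrite addr_ge0.
  move=> i j; have /andP[l u] := design_entry b i j hz (leqnn T).
  by rewrite ger0_norm.
- exact: lt_le_trans ltr01 (det_design_ge1 _ _).
- by rewrite mulr_gt0 ?ltr0n ?fact_gt0 // exprn_gt0 // ltr_pwDl.
Qed.

End EllipticalPotential.

(* The exponent compares the squared losses of the guess [g] and of the true mean [m];
   the drift [(g - m) ^+ 2 / 16] is what least squares gains in expectation. *)
Lemma expected_likelihood_le1 (R : realType) (E : finType) (D : dist R E)
    (r : E -> R) (m g : R) :
  (forall e, 0 <= r e <= 1) -> m = \sum_e D e * r e -> 0 <= g <= 1 ->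
  \sum_e D e * expR ((g - m) ^+ 2 / 16 - ((g - r e) ^+ 2 - (m - r e) ^+ 2) / 8) <= 1.
Proof.
move=> hr mE /andP[g0 g1].
have D0 := Defs.pmf_ge0 D; have D1 := Defs.pmf_sum1 D.
have m0 : 0 <= m by rewrite mE sumr_ge0 // => e _; rewrite mulr_ge0 // (andP (hr e)).1.
have m1 : m <= 1.
  by rewrite mE -D1 ler_sum // => e _; rewrite ler_piMr // (andP (hr e)).2.
set De := g - m.
have De1 : -1 <= De <= 1 by rewrite /De; lra.
(* The exponent equals [- (De ^+ 2 / 16) + De / 4 * (r e - m)]. Its second summand is at most 1/4,
   so the quadratic bound applies, and averaging will cancel the linear term. *)
have b : forall e, expR (De ^+ 2 / 16 - ((g - r e) ^+ 2 - (m - r e) ^+ 2) / 8) <=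
    expR (- (De ^+ 2 / 16)) * (1 + De / 4 * (r e - m) + De ^+ 2 / 16).
  move=> e; have /andP[r0 r1] := hr e.
  have -> : De ^+ 2 / 16 - ((g - r e) ^+ 2 - (m - r e) ^+ 2) / 8 =
     - (De ^+ 2 / 16) + De / 4 * (r e - m) by rewrite /De; field.
  rewrite expRD ler_wpM2l ?expR_ge0 //.
  have x1 : `|De * (r e - m)| <= 1.
    rewrite normrM mulr_ile1 // ler_norml; lra.
  have x2 : (De * (r e - m)) ^+ 2 <= De ^+ 2.
    rewrite exprMn ler_piMr ?sqr_ge0 // -real_normK ?num_real // exprn_ile1 // ler_norml; lra.
  apply: le_trans (expR_le_quad _) _; first by move: x1; rewrite ler_norml; lra.
  rewrite !exprMn in x2 *; lra.
apply: le_trans (_ : \sum_e D e * (expR (- (De ^+ 2 / 16)) * (1 + De / 4 * (r e - m) + De ^+ 2 / 16)) <= _).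
  by apply: ler_sum => e _; rewrite ler_wpM2l.
have -> : \sum_e D e * (expR (- (De ^+ 2 / 16)) * (1 + De / 4 * (r e - m) + De ^+ 2 / 16))
   = expR (- (De ^+ 2 / 16)) * (1 + De ^+ 2 / 16).
  under eq_bigr => e _.
    rewrite (_ : _ * _ = expR (- (De ^+ 2 / 16)) * (1 - De / 4 * m + De ^+ 2 / 16) * D e
       + expR (- (De ^+ 2 / 16)) * (De / 4) * (D e * r e)); last by ring.
    over.
  rewrite big_split -!mulr_sumr D1 -mE /=; ring.
rewrite expRN mulrC ler_pdivrMr ?expR_gt0 // mul1r; exact: expR_ge1Dx.
Qed.

(** * Runs of an adaptive algorithm *)

Section Runs.
Variables (R : realType) (E J : finType) (D : dist R E).
Variables (pick_arm : seq (J * R) -> J) (rew : J -> E -> R).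

Definition step (s : seq (J * R)) (e : E) := rcons s (pick_arm s, rew (pick_arm s) e).
Definition run (s : seq (J * R)) (es : seq E) := foldl step s es.

Lemma run_rcons s es e : run s (rcons es e) = step (run s es) e.
Proof. exact: foldl_rcons. Qed.

Lemma size_run es : size (run [::] es) = size es.
Proof. by elim/last_ind: es => // es e IH; rewrite run_rcons /step size_rcons IH size_rcons. Qed.

Lemma take_run es t : take t (run [::] es) = run [::] (take t es).
Proof.
elim/last_ind: es => // es e IH; have [lt|ge] := ltnP (size es) t.
  by rewrite !take_oversize // ?size_run size_rcons.
by rewrite run_rcons /step -!cats1 !takel_cat ?size_run.
Qed.

Lemma nth_run es t x0 e0 : (t < size es)%N ->
  nth x0 (run [::] es) t =
  (pick_arm (run [::] (take t es)), rew (pick_arm (run [::] (take t es))) (nth e0 es t)).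
Proof.
elim/last_ind: es => // es e IH; rewrite size_rcons ltnS leq_eqVlt => /orP[/eqP ->|lt].
  by rewrite run_rcons /step nth_rcons size_run ltnn eqxx nth_rcons ltnn eqxx -cats1 take_size_cat.
by rewrite run_rcons /step nth_rcons size_run lt IH // nth_rcons lt -cats1 takel_cat // ltnW.
Qed.

Lemma big_tuple_cons n (F : seq E -> R) :
  \sum_(es : n.+1.-tuple E) F es = \sum_e \sum_(es : n.-tuple E) F (e :: es).
Proof.
rewrite pair_big /= (reindex (fun p : E * n.-tuple E => [tuple of p.1 :: p.2])) //=.
exists (fun es => (thead es, [tuple of behead es])) => [[e es] _|es _] /=.
  by congr (_, _); apply: val_inj.
by rewrite [in RHS](tuple_eta es); apply: val_inj.
Qed.

(** Induction on the number of rounds, peeling off the first one; hence the arbitrary initial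
    history [s]. *)
Lemma supermartingale_run (W : seq (J * R) -> R) n s :
  (forall s, \sum_e D e * W (step s e) <= W s) ->
  \sum_(es : n.-tuple E) (\prod_(e <- es) D e) * W (run s es) <= W s.
Proof.
move=> hW; elim: n s => [|n IH] s.
  rewrite (big_pred1 [tuple]) => [|es]; first by rewrite big_nil mul1r.
  by apply/esym/eqP; rewrite [es]tuple0.
rewrite (big_tuple_cons n (fun es => (\prod_(e <- es) D e) * W (run s es))).
apply: le_trans (hW s); apply: ler_sum => e _.
apply: le_trans (_ : D e * \sum_(es : n.-tuple E) (\prod_(e <- es) D e) * W (run (step s e) es) <= _).
  by rewrite mulr_sumr; apply: ler_sum => es _; rewrite big_cons mulrA.
by rewrite ler_wpM2l // Defs.pmf_ge0.
Qed.

Lemma prod_dist_ge0 (es : seq E) : 0 <= \prod_(e <- es) D e.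
Proof. by apply: prodr_ge0 => e _; exact: Defs.pmf_ge0. Qed.

(** The logarithm of a supermartingale: each summand is the exponent of [expected_likelihood_le1],
    drift included. The filter [P] selects the rounds of one block. *)
Definition log_likelihood (P : pred J) (g m : J -> R) (s : seq (J * R)) : R :=
  \sum_(x <- s | P x.1) ((g x.1 - m x.1) ^+ 2 / 16 -
     ((g x.1 - x.2) ^+ 2 - (m x.1 - x.2) ^+ 2) / 8).

Lemma expected_log_likelihood (P : pred J) (g m : J -> R) n t :
  (forall j e, 0 <= rew j e <= 1) ->
  (forall j, m j = \sum_e D e * rew j e) -> (forall j, 0 <= g j <= 1) ->
  \sum_(es : n.-tuple E) (\prod_(e <- es) D e) *
    expR (log_likelihood P g m (take t (run [::] es))) <= 1.
Proof.
move=> hr hm hg.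
(* Truncation at [t] freezes the process after [t] rounds, so it remains a supermartingale over all
   [n] rounds. *)
pose W s := expR (log_likelihood P g m (take t s)).
rewrite [X in _ <= X](_ : 1 = W [::]); last by rewrite /W /log_likelihood big_nil expR0.
apply: (@supermartingale_run W n [::]) => s; rewrite /W /step.
have D1 := Defs.pmf_sum1 D.
have [lt|ge] := ltnP (size s) t; last first.
  under eq_bigr do rewrite -cats1 takel_cat //.
  by rewrite -mulr_suml D1 mul1r.
under eq_bigr do rewrite (@take_oversize _ t (rcons _ _)) ?size_rcons //.
rewrite take_oversize; last exact: ltnW.
rewrite /log_likelihood; set j := pick_arm s.
under eq_bigr do rewrite big_rcons /=.
case: (P j); last first.
  under eq_bigr do rewrite addr0.
  by rewrite -mulr_suml D1 mul1r.
under eq_bigr do rewrite expRD mulrCA.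
rewrite -mulr_sumr ler_piMr ?expR_ge0 //.
exact: expected_likelihood_le1.
Qed.

End Runs.

Lemma sum_prod_dist_le1 (R : realType) (E : finType) (D : dist R E) n :
  \sum_(es : n.-tuple E) \prod_(e <- es) D e <= 1.
Proof.
pose one (s : seq (unit * R)) : R := 1.
have h s : \sum_e D e * one (step (fun=> tt) (fun _ _ => 0) s e) <= one s.
  by under eq_bigr do rewrite mulr1; rewrite (Defs.pmf_sum1 D).
apply: le_trans (supermartingale_run n [::] h).
by apply: ler_sum => es _; rewrite mulr1.
Qed.

(** * Optimistic least squares in finite-armed bandits *)

Lemma big_take (R : realType) (X : Type) (x0 : X) (s : seq X) (P : pred X) (F : X -> R) t :
  (t <= size s)%N ->
  \sum_(x <- take t s | P x) F x = \sum_(i < t | P (nth x0 s i)) F (nth x0 s i).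
Proof.
move=> ts; rewrite (big_nth x0) size_takel // big_mkord.
by apply: eq_big => [i|i _]; rewrite nth_take.
Qed.

(** Cauchy-Schwarz against the all-ones vector, read off from the case of the identity matrix. *)
Lemma sum_le_sqrt (R : realType) (T : nat) (a : nat -> R) (S : R) :
  \sum_(t < T) a t ^+ 2 <= S -> \sum_(t < T) a t <= Num.sqrt (T%:R * S).
Proof.
move=> hS; pose w : 'cV[R]_T := \col_i 1; pose z : 'cV[R]_T := \col_i a i.
have [_] := posdef_cauchy_schwarz w z (@posdef1 R T).
rewrite invmx1 !mul1mx.
have -> : dot w z = \sum_(t < T) a t by apply: eq_bigr => i _; rewrite !mxE mul1r.
have -> : dot w w = T%:R.
  rewrite /dot -[in RHS](card_ord T) -sum1_card natr_sum.
  by apply: eq_bigr => i _; rewrite !mxE mul1r.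
have -> : dot z z = \sum_(t < T) a t ^+ 2.
  by apply: eq_bigr => i _; rewrite !mxE expr2.
move=> h; apply: le_trans (ler_norm _) _; rewrite -sqrtr_sqr ler_wsqrtr //.
by apply: le_trans h _; rewrite ler_wpM2l.
Qed.

Section OptimisticLeastSquares.
Variables (R : realType) (J B : finType) (d T : nat).
Variables (j0 : J) (blk : J -> B) (z : J -> 'cV[R]_d).
Hypotheses (T0 : (0 < T)%N) (d0 : (0 < d)%N).
Hypothesis z01 : forall j i, 0 <= z j i 0 <= 1.

(** Mass below one is allowed so that rounding down stays admissible, and so that in dimension 1 any
    mean in the unit interval is a parameter. *)
Definition subdist (mu : 'cV[R]_d) := (forall i, 0 <= mu i 0) /\ \sum_i mu i 0 <= 1.

Definition grid := {ffun 'I_d -> 'I_(T * d).+1}.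

(* Grid vectors of total mass above one are junk and sent to [0]. *)
Definition gridpoint (h : grid) : 'cV[R]_d :=
  if (\sum_i h i <= T * d)%N then \col_i ((h i)%:R / (T * d)%:R) else 0.

Definition prediction (h : grid) (j : J) : R := dot (gridpoint h) (z j).

Lemma dot_subdist mu j : subdist mu -> 0 <= dot mu (z j) <= 1.
Proof.
move=> [mu0 mu1]; rewrite sumr_ge0 /= => [|i _]; last by rewrite mulr_ge0 // (andP (z01 _ _)).1.
apply: le_trans mu1; apply: ler_sum => i _.
by rewrite ler_piMr // (andP (z01 _ _)).2.
Qed.

Lemma subdist_le1 mu i : subdist mu -> mu i 0 <= 1.
Proof.
move=> [mu0 mu1]; apply: le_trans mu1; rewrite (bigD1 i) //= lerDl.
by apply: sumr_ge0.
Qed.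

Lemma dot_sub_subdist mu nu : subdist mu -> subdist nu -> dot (mu - nu) (mu - nu) <= d%:R.
Proof.
move=> hm hn; rewrite -[in d%:R](card_ord d) -sum1_card natr_sum.
apply: ler_sum => i _; rewrite !mxE -expr2 -real_normK ?num_real // exprn_ile1 //.
have := hm.1 i; have := hn.1 i; have := subdist_le1 i hm; have := subdist_le1 i hn.
by rewrite ler_norml; lra.
Qed.

Lemma subdist_gridpoint h : subdist (gridpoint h).
Proof.
have Td0 : 0 < (T * d)%:R :> R by rewrite ltr0n muln_gt0 T0.
rewrite /gridpoint; case: ifP => hs; split.
- by move=> i; rewrite mxE divr_ge0.
- under eq_bigr do rewrite mxE.
  by rewrite -mulr_suml ler_pdivrMr // mul1r -natr_sum ler_nat.
- by move=> i; rewrite mxE.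
- by rewrite big1 // => i _; rewrite mxE.
Qed.

(** Each coordinate is rounded down to a multiple of [(T * d)%:R^-1]. The total mass stays at most
    one, so the junk case is avoided, and the [d] coordinate errors add up to at most [T%:R^-1]. *)
Lemma gridpoint_approx mu : subdist mu ->
  {h : grid | forall j, `|prediction h j - dot mu (z j)| <= T%:R^-1}.
Proof.
move=> hmu; have [mu0 mu1] := hmu.
have Td0 : 0 < (T * d)%:R :> R by rewrite ltr0n muln_gt0 T0.
pose k i := Num.truncn (mu i 0 * (T * d)%:R).
have kT i : (k i < (T * d).+1)%N.
  rewrite ltnS /k truncn_le_nat; apply: le_lt_trans (_ : (T * d)%:R < _).
    by rewrite ler_piMl // subdist_le1.
  by rewrite ltr_nat.
have kb i : (k i)%:R <= mu i 0 * (T * d)%:R < (k i)%:R + 1.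
  by rewrite -[1]/(1%:R) -natrD addn1; apply: truncn_itv; rewrite mulr_ge0.
exists [ffun i => Ordinal (kT i)] => j.
have ks : (\sum_i [ffun i => Ordinal (kT i)] i <= T * d)%N.
  rewrite -(@ler_nat R) natr_sum.
  apply: le_trans (_ : \sum_i mu i 0 * (T * d)%:R <= _).
    by apply: ler_sum => i _; rewrite ffunE (andP (kb i)).1.
  by rewrite -mulr_suml; apply: ler_piMl => //; exact: ltW.
rewrite /prediction /gridpoint ks -dotBl /dot.
apply: le_trans (ler_norm_sum _ _ _) _.
apply: le_trans (_ : \sum_(i < d) (T * d)%:R^-1 <= _).
  apply: ler_sum => i _; rewrite !mxE ffunE /= normrM.
  have /andP[k1 k2] := kb i; have /andP[z0 z1] := z01 j i.
  apply: le_trans (_ : `|(k i)%:R / (T * d)%:R - mu i 0| <= _).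
    by rewrite ler_piMr // ger0_norm.
  have -> : (k i)%:R / (T * d)%:R - mu i 0 =
      ((k i)%:R - mu i 0 * (T * d)%:R) / (T * d)%:R by rewrite mulrBl mulfK // gt_eqF.
  rewrite normrM [`|_^-1|]ger0_norm ?invr_ge0 ?(ltW Td0) // ler_piMl ?invr_ge0 ?(ltW Td0) //.
  by rewrite ler_norml; lra.
rewrite sumr_const card_ord -[X in X <= _]mulr_natr natrM invfM -mulrA mulVf ?mulr1 //.
by rewrite pnatr_eq0 -lt0n.
Qed.

Definition loss (b : B) (h : grid) (s : seq (J * R)) : R :=
  \sum_(x <- s | blk x.1 == b) (prediction h x.1 - x.2) ^+ 2.

(* A pair (arm, hypothesis) is confident when the hypothesis nearly minimises the
   squared loss over the rounds spent in the block of the arm. *)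
Definition confident (beta : R) (s : seq (J * R)) (p : J * grid) : bool :=
  [forall h, loss (blk p.1) p.2 s <= loss (blk p.1) h s + beta].

(** Optimism in the face of uncertainty: arm and hypothesis are maximised jointly. The default
    occurs only when no pair is confident. *)
Definition optimistic (beta : R) (s : seq (J * R)) : J * grid :=
  odflt (j0, [ffun=> ord0])
    [pick p | confident beta s p &&
      [forall q, confident beta s q ==> (prediction q.2 q.1 <= prediction p.2 p.1)]].

Lemma optimisticP beta s q : confident beta s q ->
  confident beta s (optimistic beta s) /\
  prediction q.2 q.1 <= prediction (optimistic beta s).2 (optimistic beta s).1.
Proof.
move=> cq; rewrite /optimistic; case: pickP => [p /andP[cp /forallP hp]|no].
  by split => //=; have := hp q; rewrite cq.
have [p cp hp] := @Order.TotalTheory.arg_maxP _ _ _ q (confident beta s)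
   (fun p => prediction p.2 p.1) cq.
have := no p; rewrite cp /= => /negP[]; apply/forallP => q'; apply/implyP.
exact: hp.
Qed.

(** * Regret of the optimistic rule on a fixed history where all log-likelihoods are small *)

Variables (mu : B -> 'cV[R]_d) (m : J -> R) (Lg : R) (s : seq (J * R)).
Hypotheses (mu_subdist : forall b, subdist (mu b))
  (mE : forall j, m j = dot (mu (blk j)) (z j)) (Lg0 : 0 <= Lg)
  (s_size : size s = T) (s01 : forall x, x \in s -> 0 <= x.2 <= 1)
  (s_optimistic : forall t, (t < T)%N ->
     (nth (j0, 0) s t).1 = (optimistic (2 + 8 * Lg) (take t s)).1)
  (good : forall t b h, (t < T)%N ->
     log_likelihood (fun j => blk j == b) (prediction h) m (take t s) <= Lg).

Let mloss b t := \sum_(x <- take t s | blk x.1 == b) (m x.1 - x.2) ^+ 2.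
Let dev b h t := \sum_(x <- take t s | blk x.1 == b) (prediction h x.1 - m x.1) ^+ 2.

Lemma mean01 j : 0 <= m j <= 1.
Proof. by rewrite mE; exact: dot_subdist. Qed.

Lemma prediction01 h j : 0 <= prediction h j <= 1.
Proof. exact: dot_subdist (subdist_gridpoint h). Qed.

Lemma dev_le t b h : (t < T)%N ->
  dev b h t <= 2 * (loss b h (take t s) - mloss b t) + 16 * Lg.
Proof.
move=> tT; have := good b h tT; rewrite /log_likelihood sumrB -!mulr_suml sumrB.
by rewrite -/(dev b h t) -/(loss b h (take t s)) -/(mloss b t); lra.
Qed.

Lemma dev_ge0 t b h : 0 <= dev b h t.
Proof. by apply: sumr_ge0 => x _; rewrite sqr_ge0. Qed.

(** A difference of squares: each round changes the loss by at most [2 * T%:R^-1], and there are at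
    most [T] rounds. *)
Lemma loss_approx t b h : (t < T)%N ->
  (forall j, blk j = b -> `|prediction h j - m j| <= T%:R^-1) ->
  loss b h (take t s) <= mloss b t + 2.
Proof.
move=> tT hj; rewrite -lerBlDl /loss /mloss -sumrB.
have tn : T%:R != 0 :> R by rewrite pnatr_eq0 -lt0n.
apply: le_trans (_ : \sum_(x <- take t s | blk x.1 == b) 2 * T%:R^-1 <= _).
  rewrite big_seq_cond [X in _ <= X]big_seq_cond; apply: ler_sum => x /andP[xs /eqP xb].
  have /andP[r0 r1] := s01 (mem_take xs).
  have /andP[m0 m1] := mean01 x.1; have /andP[p0 p1] := prediction01 h x.1.
  have -> : (prediction h x.1 - x.2) ^+ 2 - (m x.1 - x.2) ^+ 2 =
    (prediction h x.1 + m x.1 - 2 * x.2) * (prediction h x.1 - m x.1) by ring.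
  apply: le_trans (ler_norm _) _; rewrite normrM ler_pM // ?hj //.
  by rewrite ler_norml; lra.
rewrite big_const_seq iter_addr_0 -[X in X <= _]mulr_natr -mulrA ger_pMr // mulrC ler_pdivrMr ?ltr0n //.
rewrite mul1r ler_nat (leq_trans (count_size _ _)) // size_takel ?s_size ltnW //.
Qed.

Theorem optimistic_regret jstar :
  \sum_(t < T) (m jstar - m (nth (j0, 0) s t).1) <=
  1 + Num.sqrt (T%:R * (2 * (d%:R + 8 + 32 * Lg) *
        (#|B|%:R * ln (d`!%:R * (1 + T%:R) ^+ d)))).
Proof.
have tn : T%:R != 0 :> R by rewrite pnatr_eq0 -lt0n.
pose h0 b := sval (gridpoint_approx (mu_subdist b)).
have h0P b j : blk j = b -> `|prediction (h0 b) j - m j| <= T%:R^-1.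
  by move=> jb; rewrite mE jb; exact: (svalP (gridpoint_approx (mu_subdist b))).
pose arm t := (nth (j0, 0) s t).1.
pose h t := (optimistic (2 + 8 * Lg) (take t s)).2.
pose w t := gridpoint (h t) - mu (blk (arm t)).
have opt t : (t < T)%N ->
    dev (blk (arm t)) (h t) t <= 8 + 32 * Lg /\
    m jstar - m (arm t) <= T%:R^-1 + dot (w t) (z (arm t)).
  move=> tT.
  (* The radius is chosen for this: rounding the true parameter costs at most 2, and no hypothesis
     beats the true mean by more than [8 * Lg], because its deviation is nonnegative. *)
  have c0 : confident (2 + 8 * Lg) (take t s) (jstar, h0 (blk jstar)).
    apply/forallP => h' /=.
    have := loss_approx tT (h0P (blk jstar)); have := dev_le (blk jstar) h' tT.
    have := dev_ge0 t (blk jstar) h'; lra.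
  have [/forallP cp le] := optimisticP c0.
  rewrite -s_optimistic // -/(arm t) -/(h t) in cp le; split.
    (* The chosen hypothesis loses at most [4 + 8 * Lg] more than the true mean, so [dev_le] bounds
       its deviation by [2 * (4 + 8 * Lg) + 16 * Lg]. *)
    have := cp (h0 (blk (arm t))); have := loss_approx tT (h0P (blk (arm t))).
    have := dev_le (blk (arm t)) (h t) tT; lra.
  have := h0P _ _ (erefl (blk jstar)); rewrite ler_norml => /andP[h1 _].
  have -> : dot (w t) (z (arm t)) = prediction (h t) (arm t) - m (arm t).
    by rewrite dotBl mE.
  move: le => /=; lra.
apply: le_trans (_ : \sum_(t < T) (T%:R^-1 + dot (w t) (z (arm t))) <= _).
  by apply: ler_sum => t _; have [] := opt t (ltn_ord t).
(* The [T] rounding errors of size [T%:R^-1] add up to the leading 1. *)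
rewrite big_split /= sumr_const card_ord -[X in X + _ <= _]mulr_natr mulVf // lerD2l.
apply: (@sum_le_sqrt _ _ (fun t => dot (w t) (z (arm t)))).
apply: (@elliptical_potential _ _ _ (blk \o arm) (z \o arm) T w).
- by have := ler0n R d; move: Lg0; lra.
- by move=> t i _; exact: z01.
(* The identity in the design matrix contributes the [d], the past squared deviations contribute the
   rest. *)
- move=> t tT; rewrite -addrA lerD //.
    exact: dot_sub_subdist (subdist_gridpoint _) (mu_subdist _).
  apply: (le_trans _ (opt t tT).1); rewrite /dev (big_take (j0, 0)) ?s_size ?(ltnW tT) //.
  rewrite le_eqVlt; apply/orP; left; apply/eqP; apply: eq_bigr => i /eqP ib.
  by rewrite /w dotBl mE -/(arm i) (ib : blk (arm i) = blk (arm t)).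
- move=> t tT; rewrite dotBl -mE -real_normK ?num_real // exprn_ile1 //.
  have /andP[m0 m1] := mean01 (arm t); have /andP[p0 p1] := prediction01 (h t) (arm t).
  by rewrite ler_norml; rewrite /prediction in p0 p1; lra.
Qed.

End OptimisticLeastSquares.

(** * The bandit bound in expectation *)

Lemma fact_le_exp (n : nat) : (n`! <= n ^ n)%N.
Proof.
elim: n => // n IH; rewrite factS expnS leq_mul2l /=.
by rewrite (leq_trans IH) //; case: n {IH} => // n; rewrite leq_exp2r.
Qed.

Lemma regret_rate_le (R : realType) (d b T : nat) :
  (0 < d)%N -> (0 < b)%N -> (d ^ 2 * b <= T)%N ->
  2 + Num.sqrt (T%:R * (2 * (d%:R + 8 + 32 * ln (T ^ 2 * b * (T * d).+1 ^ d)%:R) *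
        (b%:R * ln (d`!%:R * (1 + T%:R) ^+ d)))) <=
  28 * (1 + ln T%:R) * d%:R * Num.sqrt (b * T)%:R :> R.
Proof.
move=> d0 b0 dbT.
(* Both [d] and [b] are at most [T], so their logarithms are absorbed by [ln T%:R]. *)
have dT : (d <= T)%N by apply: leq_trans dbT; rewrite -mulnA -{1}[d]muln1 leq_mul // muln_gt0 d0.
have bT : (b <= T)%N by apply: leq_trans dbT; rewrite -{1}[b]mul1n leq_mul // expn_gt0 d0.
have T0 : (0 < T)%N by exact: leq_trans dT.
have Tp : 0 < T%:R :> R by rewrite ltr0n.
have T1 : 1 <= T%:R :> R by rewrite ler1n.
have d1 : 1 <= d%:R :> R by rewrite ler1n.
have b1 : 1 <= b%:R :> R by rewrite ler1n.
set l := ln (T%:R : R); have l0 : 0 <= l by rewrite ln_ge0.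
have l2 : ln (2 * T%:R ^+ 2) <= 1 + 2 * l :> R.
  rewrite lnM ?posrE ?exprn_gt0 // lnXn // -/l mulr_natl lerD2r.
  have -> : 2 = 1 + 1 :> R by [].
  exact: le_ln1Dx (lt_trans (ltrN10 _) ltr01).
have h1 : ln (T ^ 2 * b * (T * d).+1 ^ d)%:R <= 5 * d%:R * (1 + l) :> R.
  apply: le_trans (_ : ln (T%:R ^+ 3 * (2 * T%:R ^+ 2) ^+ d) <= _).
    rewrite ler_ln ?posrE ?ltr0n ?muln_gt0 ?expn_gt0 ?T0 ?b0 //; last first.
      by rewrite mulr_gt0 ?exprn_gt0 ?mulr_gt0 ?exprn_gt0.
    rewrite -!natrX -natrM -natrX -natrM ler_nat leq_mul //.
      by rewrite (expnSr T 2) leq_mul.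
    rewrite leq_exp2r // mul2n -addnn -addn1 leq_add ?expn_gt0 ?T0 //.
    by rewrite -mulnn leq_mul.
  rewrite lnM ?posrE ?exprn_gt0 ?mulr_gt0 ?exprn_gt0 // !lnXn ?mulr_gt0 ?exprn_gt0 // -/l.
  rewrite -[_ *+ d]mulr_natl -[l *+ 3]mulr_natl.
  have := ler_wpM2l (ler0n R d) l2; have := mulr_ge0 (ler0n R d) l0.
  nra.
have h2 : ln (d`!%:R * (1 + T%:R) ^+ d) <= 2 * d%:R * (1 + l) :> R.
  apply: le_trans (_ : ln ((2 * T%:R ^+ 2) ^+ d) <= _).
    rewrite ler_ln ?posrE ?mulr_gt0 ?ltr0n ?fact_gt0 ?exprn_gt0 ?mulr_gt0 ?exprn_gt0 ?ltr_pwDl //.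
    rewrite -[1]/(1%:R) -natrD -!natrX -!natrM -natrX ler_nat.
    apply: leq_trans (_ : (d ^ d * (1 + T) ^ d <= _)%N).
      by rewrite leq_mul2r fact_le_exp orbT.
    rewrite -expnMn leq_exp2r // -mulnn mulnCA leq_mul //.
    by rewrite mul2n -addnn leq_add2r.
  rewrite lnXn ?mulr_gt0 ?exprn_gt0 // -[_ *+ d]mulr_natl.
  have := ler_wpM2l (ler0n R d) l2; have := mulr_ge0 (ler0n R d) l0; nra.
set u := ln (T ^ 2 * b * (T * d).+1 ^ d)%:R in h1 *.
set v := ln (d`!%:R * (1 + T%:R) ^+ d) in h2 *.
set q := d%:R * (1 + l).
have q1 : 1 <= q by rewrite /q mulr_ege1 //; lra.
have v0 : 0 <= v.
  rewrite /v ln_ge0 // mulr_ege1 ?ler1n ?fact_gt0 // exprn_ege1 //; lra.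
set S := Num.sqrt (b * T)%:R.
have S1 : 1 <= S :> R by rewrite -[X in X <= _]sqrtr1 ler_wsqrtr // ler1n muln_gt0 b0.
have dq : d%:R <= q by rewrite /q ler_peMr //; lra.
(* Since [1 <= q] and [d%:R <= q], the first factor is at most [(1 + 8 + 32 * 5) * q = 169 * q], and
   [2 * 169 * 2 = 26 ^ 2]. The summand 2 will turn 26 into 28. *)
have key : T%:R * (2 * (d%:R + 8 + 32 * u) * (b%:R * v)) <= (26 * q * S) ^+ 2.
  have -> : (26 * q * S) ^+ 2 = T%:R * (2 * (169 * q) * (b%:R * (2 * q))).
    by rewrite [LHS]exprMn /S sqr_sqrtr // natrM; ring.
  rewrite ler_wpM2l //; apply: le_trans (_ : 2 * (169 * q) * (b%:R * v) <= _).
    rewrite ler_wpM2r ?mulr_ge0 // ler_wpM2l //.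
    rewrite -mulrA -/q in h1; lra.
  by rewrite ler_wpM2l ?mulr_ge0 // ?ler_wpM2l // -?mulrA -/q //; [lra|rewrite /q mulrA].
have : Num.sqrt (T%:R * (2 * (d%:R + 8 + 32 * u) * (b%:R * v))) <= 26 * q * S.
  rewrite -[X in _ <= X]ger0_norm ?mulr_ge0 //; last 2 first.
  - lra.
  - lra.
  by rewrite -sqrtr_sqr ler_wsqrtr.
have -> : 28 * (1 + l) * d%:R * S = 28 * q * S by rewrite /q; ring.
have : 1 <= q * S by rewrite mulr_ege1.
lra.
Qed.

(** The rule is fixed before the distribution, the rewards and the parameters: it depends only on
    the features and the blocks. *)
Theorem bandit_regret (R : realType) (E J B : finType) (d T : nat) (j0 : J)
    (blk : J -> B) (z : J -> 'cV[R]_d) :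
  (0 < T)%N -> (0 < d)%N -> (forall j i, 0 <= z j i 0 <= 1) ->
  exists pick_arm : seq (J * R) -> J,
  forall (D : dist R E) (rew : J -> E -> R) (mu : B -> 'cV[R]_d),
    (forall j e, 0 <= rew j e <= 1) -> (forall b, subdist (mu b)) ->
    (forall j, dot (mu (blk j)) (z j) = \sum_e D e * rew j e) ->
  forall jstar,
    \sum_(es : T.-tuple E) (\prod_(e <- es) D e) *
      \sum_(t < T) (dot (mu (blk jstar)) (z jstar) -
         let j := pick_arm (run pick_arm rew [::] (take t es)) in
         dot (mu (blk j)) (z j)) <=
    28 * (1 + ln T%:R) * d%:R * Num.sqrt (#|B| * T)%:R.
Proof.
move=> T0 d0 z01.
have B0 : (0 < #|B|)%N by apply/card_gt0P; exists (blk j0).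
(* A union bound over rounds, blocks and grid hypotheses, with one more factor [T] because a failure
   may cost regret [T]. *)
pose N := (T ^ 2 * #|B| * (T * d).+1 ^ d)%N.
pose Lg : R := ln N%:R.
have N0 : (0 < N)%N by rewrite !muln_gt0 ?expn_gt0 ?T0 ?B0.
have Lg0 : 0 <= Lg by rewrite ln_ge0 // ler1n.
exists (fun s => (@optimistic R J B d T j0 blk z (2 + 8 * Lg) s).1 : J).
set pick_arm := (fun s => _) => D rew mu hrew hmu hm jstar.
pose m j := dot (mu (blk j)) (z j).
have m01 j : 0 <= m j <= 1 by exact: dot_subdist.
have l0 : 0 <= ln T%:R :> R by rewrite ln_ge0 // ler1n.
pose pr es := \prod_(e <- es) D e.
have pr0 es : 0 <= pr es by exact: prod_dist_ge0.
pose arm es t := pick_arm (run pick_arm rew [::] (take t es)).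
have regT es : \sum_(t < T) (m jstar - m (arm es t)) <= T%:R.
  rewrite -[in T%:R](card_ord T) -sum1_card natr_sum; apply: ler_sum => t _.
  have /andP[? ?] := m01 jstar; have /andP[? ?] := m01 (arm es t); lra.
(* For small [T] the claimed rate already exceeds the trivial bound [T]. *)
have [dbT|] := leqP (d ^ 2 * #|B|) T; last first.
  move=> /ltnW dbT; apply: le_trans (_ : T%:R <= _).
    apply: le_trans (_ : \sum_(es : T.-tuple E) pr es * T%:R <= _).
      by apply: ler_sum => es _; apply: ler_wpM2l; [exact: pr0|exact: regT].
    by rewrite -mulr_suml ler_piMl // sum_prod_dist_le1.
  have e1 : (T%:R : R) <= d%:R * Num.sqrt (#|B| * T)%:R.
    rewrite -[X in X <= _]ger0_norm // -sqrtr_sqr -[d%:R]ger0_norm // -sqrtr_sqr.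
    rewrite -sqrtrM ?sqr_ge0 // ler_wsqrtr // -!natrX -natrM ler_nat -mulnn mulnA.
    by rewrite leq_mul2r dbT orbT.
  rewrite -mulrA; apply: (le_trans e1); rewrite ler_peMl ?mulr_ge0 ?sqrtr_ge0 //.
  lra.
apply: le_trans (regret_rate_le R d0 B0 dbT); rewrite -/N -/Lg.
set bound := Num.sqrt _.
pose ll es t b h := log_likelihood (fun j => blk j == b) (prediction z (T := T) h) m
  (take t (run pick_arm rew [::] es)).
(* Markov's inequality made pointwise: if some log-likelihood exceeds [Lg], its term in the sum is
   at least 1 and pays for the trivial regret [T]; otherwise the deterministic bound applies. *)
have pw (es : T.-tuple E) : \sum_(t < T) (m jstar - m (arm es t)) <=
    (1 + bound) + T%:R * \sum_(t < T) \sum_b \sum_(h : grid d T) expR (ll es t b h) * expR (- Lg).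
  have bad0 : 0 <= \sum_(t < T) \sum_b \sum_(h : grid d T) expR (ll es t b h) * expR (- Lg).
    by do 3!apply: sumr_ge0 => ? _; rewrite mulr_ge0 ?expR_ge0.
  have bd0 : 0 <= 1 + bound by rewrite addr_ge0 // sqrtr_ge0.
  have [/existsP[t /existsP[b /existsP[h lt]]]|/existsPn good] :=
      boolP [exists t : 'I_T, [exists b, [exists h : grid d T, Lg < ll es t b h]]].
    apply: le_trans (regT es) _; apply: ler_wpDl => //.
    rewrite ler_peMr // (bigD1 t) //= (bigD1 b) //= (bigD1 h) //=.
    rewrite -!addrA ler_wpDr //; first by do ?apply: addr_ge0; do ?(apply: sumr_ge0 => ? _); rewrite ?mulr_ge0 ?expR_ge0.
    by rewrite -expRD -expR0 ler_expR subr_ge0 ltW.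
  apply: ler_wpDr; first by rewrite mulr_ge0.
  have es_size := size_tuple es.
  have e0 : E by move: es_size; case: (val es) => [sz|e //]; move: T0; rewrite -sz.
  have armE (t : nat) : (t < T)%N -> arm es t = (nth (j0, 0) (run pick_arm rew [::] es) t).1.
    by move=> tT; rewrite (nth_run _ _ _ e0) ?es_size.
  under eq_bigr => t _ do rewrite armE //.
  apply: (@optimistic_regret R J B d T j0 blk z T0 d0 z01 mu m Lg) => //.
  - by rewrite size_run.
  - move=> x /(nthP (j0, 0))[t]; rewrite size_run => tT <-.
    by rewrite (nth_run _ _ _ e0) //=; exact: hrew.
  - by move=> t tT; rewrite -armE // /arm take_run.
  - move=> t b h tT; have := good (Ordinal tT) => /existsPn/(_ b)/existsPn/(_ h).
    by rewrite -leNgt.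
apply: le_trans (_ : \sum_(es : T.-tuple E) pr es * ((1 + bound) + T%:R *
  \sum_(t < T) \sum_b \sum_(h : grid d T) expR (ll es t b h) * expR (- Lg)) <= _).
  by apply: ler_sum => es _; apply: ler_wpM2l; [exact: pr0|exact: pw].
have -> : 2 + bound = (1 + bound) + 1 by ring.
under eq_bigr do rewrite mulrDr; rewrite big_split /= lerD //.
  by rewrite -mulr_suml ler_piMl ?addr_ge0 ?sqrtr_ge0 // sum_prod_dist_le1.
apply: le_trans (_ : T%:R * \sum_(t < T) \sum_(b : B) \sum_(h : grid d T) expR (- Lg) <= _).
  under eq_bigr do rewrite mulrCA; rewrite -mulr_sumr ler_wpM2l //.
  under eq_bigr do rewrite mulr_sumr; rewrite exchange_big /=; apply: ler_sum => t _.
  under eq_bigr do rewrite mulr_sumr; rewrite exchange_big /=; apply: ler_sum => b _.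
  under eq_bigr do rewrite mulr_sumr; rewrite exchange_big /=; apply: ler_sum => h _.
  under eq_bigr do rewrite mulrA; rewrite -mulr_suml ler_piMl ?expR_ge0 //.
  apply: expected_log_likelihood => // j.
  exact: prediction01.
rewrite !sumr_const /Lg expRN lnK ?posrE ?ltr0n // card_ffun !card_ord.
rewrite -!mulrnA -[X in _ * X]mulr_natl mulrA -natrM ler_pdivrMr ?ltr0n // mul1r ler_nat /N.
change #|xpredT| with #|B|; rewrite -mulnn; apply/eq_leq; ring.
Qed.

(** * Vertices of the wall arrangement *)

Section Vertices.
Variables (R : realType) (L : nat) (I : finType) (c : I -> 'I_L.+1 -> R).
Implicit Types (w f : 'I_L.+1 -> R) (x y : mixed R L.+1).

Lemma mixed_eq x y : x =1 y -> x = y.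
Proof.
case: x y => [f f0 f1] [h h0 h1] /= /funext fh; subst h.
by congr Dist; exact: Prop_irrelevance.
Qed.

Definition pairing f w : R := \sum_l w l * f l.

Lemma pairingDZ f w w' (a : R) :
  pairing f (fun l => w l + a * w' l) = pairing f w + a * pairing f w'.
Proof. by rewrite /pairing mulr_sumr -big_split; apply: eq_bigr => l _ /=; ring. Qed.

(** Coordinate 0 is eliminated through the zero sum, so directions in the simplex become free
    vectors of length [L]. *)
Lemma pairing_lift f w : \sum_l w l = 0 ->
  pairing f w = \sum_(j < L) w (lift ord0 j) * (f (lift ord0 j) - f ord0).
Proof.
rewrite /pairing !big_ord_recl => /eqP; rewrite addr_eq0 => /eqP ->.
rewrite mulNr mulr_suml addrC -sumrB.
by apply: eq_bigr => j _; rewrite mulrBr.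
Qed.

Definition tight y : {set I} := [set s | pairing (c s) y == 0].

Hypothesis coordinates : forall l, exists s, c s =1 fun l' => (l' == l)%:R.

Lemma pairing_delta l w : pairing (fun l' => (l' == l)%:R) w = w l.
Proof.
rewrite /pairing (bigD1 l) //= eqxx mulr1 big1 ?addr0 // => l' /negbTE ->.
by rewrite mulr0.
Qed.

Lemma pairing_coordinate l s w : c s =1 (fun l' => (l' == l)%:R) -> pairing (c s) w = w l.
Proof.
by move=> cs; rewrite -(pairing_delta l w) /pairing; apply: eq_bigr => l' _; rewrite cs.
Qed.

(** Only nonnegative forms constrain [y]. In the application each indifference wall occurs with both
    signs, so this is the closed cell of [x0]. *)
Definition in_cell x0 y := forall s, 0 <= pairing (c s) x0 -> 0 <= pairing (c s) y.

(* [w] has a negative coordinate, so moving along [w] eventually hits a wall that was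
   not tight at [y]; the first such wall is hit inside the cell. *)
Lemma slide_to_face x0 y f w :
  in_cell x0 y -> \sum_l w l = 0 -> (exists l, w l != 0) -> 0 <= pairing f w ->
  (forall s, s \in tight y -> pairing (c s) w = 0) ->
  exists y', [/\ in_cell x0 y', pairing f y <= pairing f y' & tight y \proper tight y'].
Proof.
move=> cy w0 [l1 wl1] fw tw.
have tight_pos s : 0 <= pairing (c s) x0 -> pairing (c s) w < 0 -> 0 < pairing (c s) y.
  move=> hs ws; have := cy s hs; rewrite le_eqVlt => /orP[/eqP/esym ys|//].
  by move: ws; rewrite tw ?ltxx // inE ys.
have [l wl] : exists l, w l < 0.
  apply: contrapT => /forallNP nw.
  have wge l : 0 <= w l by rewrite leNgt; apply/negP; exact: nw.
  move/eqP: w0; rewrite psumr_eq0 // => /allP/(_ l1 (mem_index_enum _)) /=.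
  exact/negP.
have [s0 cs0] := coordinates l.
(* The ratio test of the simplex method, over the walls that bound the cell and decrease along [w];
   the coordinate [l] guarantees that there is one. *)
pose Q s := (0 <= pairing (c s) x0) && (pairing (c s) w < 0).
have Q0 : Q s0 by rewrite /Q !(pairing_coordinate _ cs0) wl Defs.pmf_ge0.
pose ratio s := pairing (c s) y / - pairing (c s) w.
have [s1 /andP[s1x s1w] s1min] := @Order.TotalTheory.arg_minP _ _ _ s0 Q ratio Q0.
pose tau := ratio s1.
have tau0 : 0 <= tau by rewrite /tau /ratio divr_ge0 ?oppr_ge0 ?(ltW s1w) //; exact: cy.
pose y' l := y l + tau * w l.
have y'E s : pairing (c s) y' = pairing (c s) y + tau * pairing (c s) w by exact: pairingDZ.
have cell s : 0 <= pairing (c s) x0 -> 0 <= pairing (c s) y'.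
  move=> sx; rewrite y'E; have [ws|ws] := leP 0 (pairing (c s) w).
    by apply: addr_ge0; [exact: cy|exact: mulr_ge0].
  have := s1min s; rewrite /Q sx ws /= => /(_ isT).
  by rewrite -/tau /ratio ler_pdivlMr ?oppr_gt0 // mulrN; lra.
have y'0 k : 0 <= y' k.
  have [s cs] := coordinates k; have := cell s.
  by rewrite !(pairing_coordinate _ cs); apply; exact: Defs.pmf_ge0.
have y'1 : \sum_k y' k = 1.
  by rewrite /y' big_split /= -mulr_sumr w0 mulr0 addr0 (Defs.pmf_sum1 y).
exists (Dist y'0 y'1); split => //=.
  by rewrite (pairingDZ f y w tau) lerDl mulr_ge0.
apply/properP; split.
  apply/fintype.subsetP => s sy; have := tw s sy; move: sy; rewrite !inE => /eqP ys ws.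
  by rewrite y'E ys ws mulr0 addr0.
exists s1; rewrite !inE.
  have s1w0 : pairing (c s1) w != 0 by rewrite lt_eqF.
  by rewrite y'E /tau /ratio; apply/eqP; field; rewrite ?oppr_eq0.
by rewrite gt_eqF // tight_pos.
Qed.

(** While some nonzero zero-sum direction preserves all tight walls, a slide along it or its
    opposite, whichever does not decrease [f], makes another wall tight. The induction is on the
    number of walls not yet tight. *)
Lemma cell_optimum x0 f : exists y,
  [/\ in_cell x0 y, pairing f x0 <= pairing f y &
      forall w, \sum_l w l = 0 -> (forall s, s \in tight y -> pairing (c s) w = 0) ->
        forall l, w l = 0].
Proof.
suff H k y : (#|I| - #|tight y| <= k)%N -> in_cell x0 y -> pairing f x0 <= pairing f y ->
   exists y, [/\ in_cell x0 y, pairing f x0 <= pairing f y &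
      forall w, \sum_l w l = 0 -> (forall s, s \in tight y -> pairing (c s) w = 0) ->
        forall l, w l = 0].
  by apply: (H #|I| x0) => //; exact: leq_subr.
elim: k y => [|k IH] y hk cy fy.
all: have [[w [w0 tw wn]]|no] := pselect (exists w,
  [/\ \sum_l w l = 0, (forall s, s \in tight y -> pairing (c s) w = 0) & exists l, w l != 0]);
  last by exists y; split=> // w w0 tw l; apply/eqP/negP => wl; apply: no; exists w; split=> //; exists l; apply/negP.
all: have [y' [cy' fy' ty']] : exists y', [/\ in_cell x0 y', pairing f y <= pairing f y' & tight y \proper tight y'].
1,3: have [fw|fw] := leP 0 (pairing f w); first exact: (slide_to_face cy w0 wn).
1,2: have pN h : pairing h (fun l => - w l) = - pairing h w
      by rewrite /pairing -sumrN; apply: eq_bigr => l _; rewrite mulNr.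
1,2: apply: (@slide_to_face _ _ _ (fun l => - w l)) => //;
  [by rewrite sumrN w0 oppr0 | by have [l wl] := wn; exists l; rewrite oppr_eq0
  | by rewrite pN oppr_ge0 ltW | by move=> s sy; rewrite pN tw ?oppr0].
all: have lt := proper_card ty'; have le : (#|tight y'| <= #|I|)%N := max_card _.
  by move: lt le hk; lia.
apply: (IH y') => //; last exact: le_trans fy'.
by move: lt le hk; lia.
Qed.

(** The tight walls determine the point, so their restrictions to zero-sum directions have rank [L];
    [S] collects [L] independent ones. *)
Lemma cell_vertex x0 f : exists y (S : {set I}),
  [/\ #|S| = L, in_cell x0 y, pairing f x0 <= pairing f y,
      forall s, s \in S -> pairing (c s) y = 0 &
      forall y', (forall s, s \in S -> pairing (c s) y' = 0) -> y' = y].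
Proof.
have [y [cy fy ker]] := cell_optimum x0 f.
pose M : 'M[R]_(#|tight y|, L) :=
  \matrix_(i, j) (c (enum_val i) (lift ord0 j) - c (enum_val i) ord0).
have Mfull : row_full M.
  rewrite /row_full -mxrank_tr -/(row_free _) -kermx_eq0; apply/eqP/row_matrixP => i.
  rewrite row0; have : row i (kermx M^T) *m M^T = 0 by rewrite -row_mul mulmx_ker row0.
  move: (row i _) => r rM.
  (* A vector of length [L] in the kernel is completed to a zero-sum direction. *)
  pose w l := if unlift ord0 l is Some j then r 0 j else - \sum_j r 0 j.
  have wl j : w (lift ord0 j) = r 0 j by rewrite /w liftK.
  have w0 : \sum_l w l = 0.
    rewrite big_ord_recl {1}/w unlift_none addrC.
    by under eq_bigr do rewrite wl; rewrite subrr.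
  apply/rowP => j; rewrite [RHS]mxE -wl; apply: ker => // s sy.
  rewrite pairing_lift //; have /rowP/(_ (enum_rank_in sy s)) := rM.
  rewrite !mxE => e0; rewrite -[RHS]e0; apply: eq_bigr => j' _.
  by rewrite !mxE wl enum_rankK_in.
pose F := fullrankfun Mfull.
pose S := [set enum_val (F j) | j : 'I_L].
exists y, S; split => //.
- by rewrite card_imset ?card_ord // => j j' /enum_val_inj /fullrankfun_inj.
- by move=> s /imsetP[j _ ->]; apply/eqP; have := enum_valP (F j); rewrite inE.
move=> y' hy'; apply: mixed_eq.
pose w l := y' l - y l.
have w0 : \sum_l w l = 0 by rewrite sumrB (Defs.pmf_sum1 y) (Defs.pmf_sum1 y') subrr.
pose u : 'cV[R]_L := \col_j w (lift ord0 j).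
have Mu : rowsub F M *m u = 0.
  apply/colP => j; rewrite !mxE.
  have e : pairing (c (enum_val (F j))) w = 0.
    have -> : pairing (c (enum_val (F j))) w =
       pairing (c (enum_val (F j))) y' - pairing (c (enum_val (F j))) y.
      by rewrite /pairing -sumrB; apply: eq_bigr => l _; rewrite mulrBl.
    rewrite hy'; last by apply/imsetP; exists j.
    rewrite sub0r.
    by have := enum_valP (F j); rewrite inE => /eqP ->; rewrite oppr0.
  rewrite -[RHS]e pairing_lift //; apply: eq_bigr => j' _.
  by rewrite !mxE mulrC.
have Fu : rowsub F M \in unitmx by exact: fullrowsub_unit.
have u0 : u = 0 by rewrite -(mulKmx Fu u) Mu mulmx0.
have wl j : w (lift ord0 j) = 0 by have /colP/(_ j) := u0; rewrite !mxE.
have w00 : w ord0 = 0 by move: w0; rewrite big_ord_recl big1 ?addr0.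
move=> l; apply/eqP; rewrite -subr_eq0 -/(w l).
by case: (unliftP ord0 l) => [j ->|->]; rewrite ?wl ?w00.
Qed.

End Vertices.

(** * Counting the walls and the candidate vertices *)

Definition deviation (A : nat) := {p : 'I_A * 'I_A | p.1 != p.2}.

Definition wall (n L A K : nat) := ('I_n * 'I_K * deviation A + 'I_L)%type.

Definition wall_form (R : realType) (n L A K : nat) (g : game R n L A K)
    (s : wall n L A K) : 'I_L -> R :=
  match s with
  | inl (i, k, p) => fun l => v g i l (val p).1 k - v g i l (val p).2 k
  | inr l => fun l' => (l' == l)%:R
  end.

Lemma card_deviation (A : nat) : (#|{: deviation A}| + A = A * A)%N.
Proof.
have cD : #|[set (a, a) | a : 'I_A]| = A by rewrite card_imset ?card_ord // => a b [].
have cA : #|{: 'I_A * 'I_A}| = (A * A)%N by rewrite card_prod card_ord.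
rewrite card_sig -{}cA -[X in (_ + X)%N]cD -(cardC [pred x : 'I_A * 'I_A | x.1 != x.2]).
congr (_ + _)%N; apply: eq_card => -[a b]; rewrite !inE /= negbK.
by apply/imsetP/eqP => [[c _ [-> ->]]|->] //; exists b.
Qed.

Lemma bin_le_exp (m k : nat) : ('C(m.+1 + k, k) <= m.+2 ^ k)%N.
Proof.
elim: k => [|k IH]; first by rewrite bin0.
rewrite -(leq_pmul2l (ltn0Sn k)) -mul_bin_diag addnS /= expnS mulnA leq_mul //.
lia.
Qed.

(** Arms are labels: wall sets that do not determine a point are kept, since only an upper bound on
    their number matters. With [L.+1] actions, [L] walls suffice. *)
Definition arm (n L A K : nat) := {S : {set wall n L.+1 A K} | #|S| == L}.

Lemma card_arm (n L A K : nat) : (1 <= n)%N -> (1 <= A)%N -> (1 <= K)%N ->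
  (#|{: arm n L A K}| <=
     n ^ L.+1 * K ^ L.+1 * A ^ (2 * L.+1) * L.+1)%N.
Proof.
move=> n0 A0 K0; rewrite card_sig -cardsE card_draws card_sum !card_prod !card_ord.
have M0 : (0 < n * K * A ^ 2)%N by rewrite !muln_gt0 n0 K0 ?expn_gt0 A0.
rewrite expnM -!expnMn.
(* With a single action only the coordinate walls remain, and there are [L.+1] choices. Otherwise
   [n * K * (A ^ 2 - A) + 2 <= n * K * A ^ 2]. *)
have [A1|A2] := leqP A 1.
  have -> : #|{: deviation A}| = 0%N by have := card_deviation A; nia.
  by rewrite muln0 add0n binSn leq_pmull // expn_gt0 M0.
set m := (n * K * #|_|)%N.
apply: leq_trans (_ : m.+2 ^ L <= _)%N; first by rewrite addnS -addSn bin_le_exp.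
apply: leq_trans (_ : (n * K * A ^ 2) ^ L <= _)%N; last first.
  set Q := (n * K * A ^ 2)%N in M0 *.
  by rewrite expnS mulnAC; apply: leq_pmull; rewrite muln_gt0 M0.
have [->|L0] := posnP L; first by [].
rewrite leq_exp2r // /m; have nK : (0 < n * K)%N by rewrite muln_gt0 n0.
have := card_deviation A; set D := #|_|; set q := (n * K)%N in nK *; rewrite -mulnn; nia.
Qed.

(** * The game as a bandit whose arms are the vertices *)

Lemma measurable_fun_unit (d : measure_display) (T : measurableType d) (f : unit -> T) :
  measurable_fun [set: unit] f.
Proof.
rewrite (_ : f = cst (f tt)); first exact: measurable_cst.
by apply/funext => -[].
Qed.

Section Arms.
Variables (R : realType) (n L A K : nat) (g : game R n L.+1 A K).
Variable br : response_map R n L.+1 A K.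
Hypothesis br_favoring : leader_favoring_response g br.
Implicit Types (D : dist R (type_profile n K)) (x y : mixed R L.+1).

Definition pure_strategy : mixed R L.+1.
Proof.
exists (fun l => (l == ord0)%:R) => [l|]; first by rewrite ler0n.
by rewrite (bigD1 ord0) //= big1 ?addr0 // => l /negbTE ->.
Defined.

Definition is_vertex (S : {set wall n L.+1 A K}) y :=
  (forall s, s \in S -> pairing (wall_form g s) y = 0) /\
  (forall y', (forall s, s \in S -> pairing (wall_form g s) y' = 0) -> y' = y).

(* Junk value [pure_strategy] when the walls in [j] do not meet in a single point. *)
Definition vertex (j : arm n L A K) : mixed R L.+1 :=
  if pselect (exists y, is_vertex (val j) y) is left ex then projT1 (cid ex)
  else pure_strategy.

Definition reward (j : arm n L A K) (th : type_profile n K) : R :=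
  leader_utility g (vertex j) (br th (vertex j)).

Lemma leader_utility01 x a : 0 <= leader_utility g x a <= 1.
Proof.
rewrite sumr_ge0 /= => [|l _]; last first.
  by rewrite mulr_ge0 ?Defs.pmf_ge0 // (andP (u_bounded g l a)).1.
rewrite -(Defs.pmf_sum1 x); apply: ler_sum => l _.
by rewrite ler_piMr ?Defs.pmf_ge0 // (andP (u_bounded g l a)).2.
Qed.

Lemma reward01 j th : 0 <= reward j th <= 1.
Proof. exact: leader_utility01. Qed.

(* Moving from [x] inside its cell keeps every response [br th x] a best response,
   so the utility there dominates the linear function obtained by freezing the responses. *)
Lemma cell_utility D x y : in_cell (wall_form g) x y ->
  \sum_th D th * leader_utility g y (br th x) <= expected_utility g br D y.
Proof.
move=> cell; apply: ler_sum => th _; rewrite ler_wpM2l ?Defs.pmf_ge0 //.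
have [_ fav] := br_favoring th y; apply: fav => i b'.
have [->|ne] := eqVneq (br th x i) b'; first by [].
pose s : wall n L.+1 A K := inl (i, th i, exist (fun p => p.1 != p.2) (br th x i, b') ne).
have E (w : mixed R L.+1) : pairing (wall_form g s) w =
    follower_utility g i w (br th x i) (th i) - follower_utility g i w b' (th i).
  by rewrite /pairing /follower_utility -sumrB; apply: eq_bigr => l _; rewrite /= mulrBr.
rewrite -subr_ge0 -E; apply: cell; rewrite E subr_ge0.
by have [/(_ i)/(_ b')] := br_favoring th x.
Qed.

(** [f] is the leader's utility with responses frozen at [x]; a vertex of the cell of [x] does at
    least as well for [f], and [cell_utility] transfers this to the true utility. *)
Lemma vertex_optimal D x : exists j : arm n L A K,
  expected_utility g br D x <= expected_utility g br D (vertex j).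
Proof.
pose f l := \sum_th D th * u g l (br th x).
have fE w : pairing f w = \sum_th D th * \sum_l w l * u g l (br th x).
  rewrite /pairing /f; under eq_bigr do rewrite mulr_sumr.
  rewrite exchange_big; apply: eq_bigr => th _; rewrite mulr_sumr.
  by apply: eq_bigr => l _; rewrite mulrCA.
have coord l : exists s : wall n L.+1 A K, wall_form g s =1 (fun l' => (l' == l)%:R).
  by exists (inr l).
have [y [S [/eqP cS cell fy yS yu]]] := cell_vertex coord x f.
(* Whatever point the choice operator returns, uniqueness makes it [y]. *)
exists (exist _ S cS); have -> : vertex (exist _ S cS) = y.
  rewrite /vertex; case: pselect => [ex|[]]; last by exists y.
  by case: (cid ex) => y' [y'S _] /=; exact: yu.
by apply: le_trans (cell_utility D cell); move: fy; rewrite !fE.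
Qed.

(** Replays the rule on the observed actions to recover the past arms and rewards; the types are
    never consulted. *)
Definition arm_data (pick_arm : seq (arm n L A K * R) -> arm n L A K)
    (h : seq (action_profile n A)) : seq (arm n L A K * R) :=
  foldl (fun s a => rcons s (pick_arm s, leader_utility g (vertex (pick_arm s)) a)) [::] h.

(** The algorithm is deterministic: its seed is a single point with a Dirac law. *)
Definition arm_algorithm (pick_arm : seq (arm n L A K * R) -> arm n L A K) :
  action_feedback_algorithm R n L.+1 A :=
  @Algorithm R n L.+1 A _ unit (dirac tt)
    (fun _ h => vertex (pick_arm (arm_data pick_arm h)))
    (fun h l => measurable_cst _).

Lemma arm_data_observed pick_arm (w : seed (arm_algorithm pick_arm)) ths :
  arm_data pick_arm (observed_actions br w ths) = run pick_arm reward [::] ths.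
Proof.
elim/last_ind: ths => // ths th IH.
by rewrite /observed_actions foldl_rcons run_rcons /arm_data foldl_rcons /step -IH.
Qed.

Lemma arm_algorithm_regret T D xs (jstar : arm n L A K) pick_arm (bound : R) :
  expected_utility g br D xs <= expected_utility g br D (vertex jstar) ->
  \sum_(ths : T.-tuple (type_profile n K)) (\prod_(th <- ths) D th) *
    \sum_(t < T) (expected_utility g br D (vertex jstar) -
      expected_utility g br D (vertex (pick_arm (run pick_arm reward [::] (take t ths)))))
    <= bound ->
  (forall ths : T.-tuple (type_profile n K),
     measurable_fun [set: seed (arm_algorithm pick_arm)]
       (fun w => regret g br D xs w ths)) /\
  (expected_regret T g br D xs (arm_algorithm pick_arm) <= bound%:E)%E.
Proof.
move=> hj hb; split=> [ths|]; first exact: measurable_fun_unit.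
rewrite /expected_regret unlock /= integral_dirac //=.
rewrite diracT mul1e lee_fin; apply: le_trans hb.
apply: ler_sum => ths _; apply: ler_wpM2l; first exact: prod_dist_ge0.
apply: ler_sum => t _; rewrite /played_strategy /= arm_data_observed.
by rewrite lerD2r.
Qed.

End Arms.

Theorem corollary5p1 (R : realType) :
  exists (C : R) (p : nat), 0 < C /\
  forall n L A K T : nat,
    (1 <= n)%N -> (2 <= L)%N -> (1 <= A)%N -> (1 <= K)%N -> (1 <= T)%N ->
  forall (g : game R n L A K) (br : response_map R n L A K),
    leader_favoring_response g br ->
  exists alg : action_feedback_algorithm R n L A,
  forall (D : dist R (type_profile n K)) (xs : mixed R L),
    optimal_strategy g br D xs ->
    (forall ths : T.-tuple (type_profile n K),
       measurable_fun [set: seed alg]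
         (fun w => regret g br D xs w ths)) /\
    (expected_regret T g br D xs alg <=
       (C * (1 + ln T%:R) ^+ p *
        Num.min (K ^ n)%:R (Num.sqrt (n ^ L * K ^ L * A ^ (2 * L) * L)%:R) *
        Num.sqrt T%:R)%:E)%E.
Proof.
exists 28, 1%N; split=> // n L A K T n0 L2 A0 K0 T0; case: L L2 => // L L1 g br hbr.
rewrite expr1; set Q := (n ^ L.+1 * _ * _ * _)%N.
have cJ : (#|{: arm n L A K}| <= Q)%N by exact: card_arm.
(* The coordinates alone provide more than [L] walls, so a default arm exists. *)
have /card_gt0P[j0 _] : (0 < #|{: arm n L A K}|)%N.
  by rewrite card_sig -cardsE card_draws bin_gt0 card_sum [X in (_ + X)%N]card_ord addnS leqW ?leq_addl.
have rate0 : 0 <= 28 * (1 + ln T%:R) :> R.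
  by rewrite mulr_ge0 // addr_ge0 // ln_ge0 // ler1n.
have [le|lt] := leP ((K ^ n)%:R : R) (Num.sqrt Q%:R).
- pose d := #|{: type_profile n K}|.
  have dE : d = (K ^ n)%N by rewrite /d card_ffun !card_ord.
  (* The feature of an arm lists its reward under every type profile, so its mean reward is the
     pairing with [D]. The features depend on [g] and [br] but not on [D]. *)
  pose z (j : arm n L A K) : 'cV[R]_d := \col_i reward g br j (enum_val i).
  have [|||pick_arm Hp] := @bandit_regret R (type_profile n K) _ unit d T j0 (fun=> tt) z.
  + by [].
  + by rewrite dE expn_gt0 K0.
  + by move=> j i; rewrite mxE; exact: reward01.
  exists (arm_algorithm g pick_arm) => D xs _.
  have [jstar hj] := vertex_optimal hbr D xs.
  pose mu (b : unit) : 'cV[R]_d := \col_i D (enum_val i).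
  have meanE j : dot (mu tt) (z j) = expected_utility g br D (vertex g j).
    rewrite /expected_utility [RHS]big_enum_val.
    by apply: eq_bigr => i _; rewrite !mxE.
  apply: arm_algorithm_regret hj _.
  have := Hp D (reward g br) mu (reward01 g br) _ meanE jstar.
  rewrite card_unit mul1n -dE => H.
  apply: le_trans (H _) => [|b]; last first.
    split=> [i|]; first by rewrite mxE Defs.pmf_ge0.
    by under eq_bigr do rewrite mxE; rewrite -(Defs.pmf_sum1 D) [X in _ <= X]big_enum_val.
  by apply: ler_sum => ths _; rewrite meanE; under [X in _ <= _ * X]eq_bigr do rewrite /= meanE.
(* Every arm is its own block with constant feature 1, so the parameter is the mean reward and
   nothing is shared between arms. *)
- pose z (j : arm n L A K) : 'cV[R]_1 := const_mx 1.
  have [|||pick_arm Hp] := @bandit_regret R (type_profile n K) _ _ 1 T j0 id z.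
  + by [].
  + by [].
  + by move=> j i; rewrite mxE ler01 lexx.
  exists (arm_algorithm g pick_arm) => D xs _.
  have [jstar hj] := vertex_optimal hbr D xs.
  pose mu j : 'cV[R]_1 := const_mx (expected_utility g br D (vertex g j)).
  have meanE j : dot (mu j) (z j) = expected_utility g br D (vertex g j).
    by rewrite /dot big_ord1 !mxE mulr1.
  have U01 j : 0 <= expected_utility g br D (vertex g j) <= 1.
    rewrite sumr_ge0 /= => [|th _]; last first.
      by rewrite mulr_ge0 ?Defs.pmf_ge0 // (andP (reward01 g br j th)).1.
    rewrite -(Defs.pmf_sum1 D); apply: ler_sum => th _.
    by rewrite ler_piMr ?Defs.pmf_ge0 // (andP (reward01 g br j th)).2.
  apply: arm_algorithm_regret hj _.
  have := Hp D (reward g br) mu (reward01 g br) _ meanE jstar.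
  rewrite mulr1 => H; apply: le_trans (le_trans (H _) _).
  + by apply: ler_sum => ths _; rewrite meanE; under [X in _ <= _ * X]eq_bigr do rewrite /= meanE.
  + move=> j; split=> [i|]; first by rewrite mxE (andP (U01 j)).1.
    by rewrite big_ord1 mxE (andP (U01 j)).2.
  + by rewrite -[X in _ <= X]mulrA ler_wpM2l // -sqrtrM // ler_wsqrtr // -natrM ler_nat leq_mul2r cJ orbT.
Qed.
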